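(* Let $\tau\in\prod_{p\in\mathbb P}\mathbb J_p$ be arbitrary. Then the ring $R_\tau$ is not $k$-stage Euclidean for any positive integer $k$.
   Context: $\mathbb P$ is the set of all primes in $\mathbb N$. For $p\in\mathbb P$, $\mathbb J_p$ is the ring of $p$-adic integers, which contains $\mathbb Z$ canonically. For $k\ge 1$, $\pi_k:\mathbb J_p\to\mathbb Z/p^k\mathbb Z$ is the canonical projection, and $\pi_0:\mathbb J_p\to\{0\}$ is the zero map (the prime $p$ is suppressed in the notation). $\mathrm v_p$ is the usual $p$-adic valuation. For $\tau=(\tau_p)_{p\in\mathbb P}\in\prod_{p\in\mathbb P}\mathbb J_p$, define the subring of $\mathbb Q[x]$ $$R_\tau=\left\{\frac{h}{n}\in\mathbb Q[x]\ \Big|\ n\in\mathbb N\setminus\{0\},\ h\in\mathbb Z[x],\ \text{and } \pi_{\mathrm v_p(n)}(h(\tau_p))=0 \text{ for all } p\in\mathbb P\right\},$$ where $h(\tau_p)$ is evaluated in $\mathbb J_p$. Let $R$ be a commutative domain. For $(a,b)\in R^2$ and a non-negative integer $l$, an $l$-stage division chain starting from $(a,b)$ consists of quotients $q_1,\dots,q_l\in R$ and remainders $r_1,\dots,r_l\in R$ such that, with $r_{-1}=a$ and $r_0=b$, one has $r_{i-2}=q_ir_{i-1}+r_i$ for $i=1,\dots,l$. A norm on $R$ is a function $N:R\to\mathbb N$ with $N(a)=0$ if and only if $a=0$. For a positive integer $k$, $R$ is $k$-stage Euclidean with respect to $N$ if for every $(a,b)\in R^2$ with $b\neq 0$ there exist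 a positive integer $l\le k$ and an $l$-stage division chain starting from $(a,b)$ with $N(r_l)<N(b)$. $R$ is $k$-stage Euclidean if it is $k$-stage Euclidean with respect to some norm $N$ on $R$. *)

(* Defs.v *)
From HB Require Import structures.
From mathcomp Require Import all_boot all_order all_algebra.
From mathcomp Require Import boolp.

Set Implicit Arguments.
Unset Strict Implicit.
Unset Printing Implicit Defensive.

Import GRing.Theory.
Local Open Scope ring_scope.

Definition primes_nat := {p : nat | prime p}.

(* Z/nZ for every n > 0, as the library's 'I_m.+1 with m = n.-1. Unlike 'Z_n
   it is also right for n = 1, where it is the trivial group 'I_1. *)
Definition zmod_pow (p k : nat) := 'I_(p ^ k).-1.+1.
HB.instance Definition _ p k := GRing.Zmodule.on (zmod_pow p k).

(* The ring of p-adic integers, as the inverse limit of the rings Z/p^k. *)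
Record padic (p : primes_nat) := Padic {
  padic_seq : forall k : nat, zmod_pow (val p) k;
  padic_compat : forall k, inZp (padic_seq k.+1) = padic_seq k
}.

Definition padic_proj (p : primes_nat) (k : nat) (x : padic p) :
  zmod_pow (val p) k := padic_seq x k.

HB.instance Definition _ p := gen_eqMixin (padic p).
HB.instance Definition _ p := gen_choiceMixin (padic p).

Section PadicRing.
Variable p : primes_nat.
Implicit Types x y z : padic p.

Lemma pow_predK k : (val p ^ k).-1.+1 = (val p ^ k)%N.
Proof. by rewrite prednK // expn_gt0 prime_gt0 ?(valP p). Qed.

Lemma dvdn_pow_predK j k : (j <= k)%N ->
  ((val p ^ j).-1.+1 %| (val p ^ k).-1.+1)%N.
Proof. by move=> jk; rewrite !pow_predK dvdn_exp2l. Qed.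

Lemma padic_eqP x y :
  (forall k, padic_proj k x = padic_proj k y) -> x = y.
Proof.
case: x y => [x cx] [y cy]; rewrite /padic_proj /= => xy.
have {}xy : x = y by apply: functional_extensionality_dep.
by case: _ / xy in cy *; congr Padic; exact: Prop_irrelevance.
Qed.

Lemma padic_of_nat_subproof n k :
  inZp (inZp n : zmod_pow (val p) k.+1) = inZp n :> zmod_pow (val p) k.
Proof. by apply: val_inj; rewrite /= modn_dvdm ?dvdn_pow_predK. Qed.

Lemma padic_opp_subproof x k :
  inZp (Zp_opp (padic_seq x k.+1)) = Zp_opp (padic_seq x k).
Proof.
rewrite -(padic_compat x k); apply: val_inj => /=.
set a := nat_of_ord _; set m := (_ ^ k).-1.+1; set M := (_ ^ k.+1).-1.+1.
have mM : (m %| M)%N by exact: dvdn_pow_predK.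
have aM : (a <= M)%N by apply: ltnW; exact: ltn_ord.
rewrite modn_dvdm //; apply/eqP.
rewrite -(eqn_modDr (a %% m)) subnK; last by apply: ltnW; rewrite ltn_pmod.
by rewrite modnDmr subnK // modnn; exact: mM.
Qed.

Lemma padic_add_subproof x y k :
  inZp (Zp_add (padic_seq x k.+1) (padic_seq y k.+1)) =
  Zp_add (padic_seq x k) (padic_seq y k).
Proof.
rewrite -(padic_compat x k) -(padic_compat y k); apply: val_inj => /=.
by rewrite modn_dvdm ?dvdn_pow_predK // modnDm.
Qed.

Lemma padic_mul_subproof x y k :
  inZp (Zp_mul (padic_seq x k.+1) (padic_seq y k.+1)) =
  Zp_mul (padic_seq x k) (padic_seq y k).
Proof.
rewrite -(padic_compat x k) -(padic_compat y k); apply: val_inj => /=.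
by rewrite modn_dvdm ?dvdn_pow_predK // modnMm.
Qed.

Definition padic_of_nat n := Padic (padic_of_nat_subproof n).
Definition padic_opp x := Padic (padic_opp_subproof x).
Definition padic_add x y := Padic (padic_add_subproof x y).
Definition padic_mul x y := Padic (padic_mul_subproof x y).

Fact padic_addA : associative padic_add.
Proof. by move=> x y z; apply: padic_eqP => k; exact: Zp_addA. Qed.

Fact padic_addC : commutative padic_add.
Proof. by move=> x y; apply: padic_eqP => k; exact: Zp_addC. Qed.

Fact padic_add0 : left_id (padic_of_nat 0) padic_add.
Proof.
move=> x; apply: padic_eqP => k; rewrite -[RHS]Zp_add0z.
by apply: val_inj; rewrite /= mod0n.
Qed.

Fact padic_addN : left_inverse (padic_of_nat 0) padic_opp padic_add.
Proof.
move=> x; apply: padic_eqP => k; rewrite /padic_proj /= Zp_addNz.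
by apply: val_inj; rewrite /= mod0n.
Qed.

HB.instance Definition _ := GRing.isZmodule.Build (padic p)
  padic_addA padic_addC padic_add0 padic_addN.

Fact padic_mulA : associative padic_mul.
Proof. by move=> x y z; apply: padic_eqP => k; exact: Zp_mulA. Qed.

Fact padic_mulC : commutative padic_mul.
Proof. by move=> x y; apply: padic_eqP => k; exact: Zp_mulC. Qed.

Fact padic_mul1 : left_id (padic_of_nat 1) padic_mul.
Proof. by move=> x; apply: padic_eqP => k; exact: Zp_mul1z. Qed.

Fact padic_mulD : left_distributive padic_mul padic_add.
Proof. by move=> x y z; apply: padic_eqP => k; exact: Zp_mul_addl. Qed.

Fact padic_oner_neq0 : padic_of_nat 1 != 0.
Proof.
apply/eqP => /(congr1 (fun x => val (padic_proj 1 x))) /=.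
by rewrite pow_predK expn1 mod0n modn_small // prime_gt1 // (valP p).
Qed.

HB.instance Definition _ := GRing.Zmodule_isComNzRing.Build (padic p)
  padic_mulA padic_mulC padic_mul1 padic_mulD padic_oner_neq0.

Lemma padic_proj0 k : padic_proj k (0 : padic p) = 0.
Proof. by apply: val_inj; rewrite /= mod0n. Qed.

Lemma padic_projD k x y : padic_proj k (x + y) = padic_proj k x + padic_proj k y.
Proof. by []. Qed.

Lemma padic_projN k x : padic_proj k (- x) = - padic_proj k x.
Proof. by []. Qed.

Lemma padic_projM k x y :
  padic_proj k (x * y) = Zp_mul (padic_proj k x) (padic_proj k y).
Proof. by []. Qed.

Lemma padic_proj_nat k n : padic_proj k (n%:R : padic p) = inZp n.
Proof.
elim: n => [|n IHn]; first by rewrite padic_proj0; apply: val_inj; rewrite /= mod0n.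
rewrite mulrS padic_projD IHn; apply: val_inj.
by rewrite /= modnDm add1n.
Qed.

Lemma padic_proj_lt k x : (padic_proj k x < val p ^ k)%N.
Proof. by exact: leq_trans (ltn_ord _) (eq_leq (pow_predK k)). Qed.

Lemma padic_proj_modn j k x : (j <= k)%N ->
  padic_proj j x = (padic_proj k x %% val p ^ j)%N :> nat.
Proof.
elim: k => [|k IHk]; first by rewrite leqn0 => /eqP->; rewrite modn_small ?padic_proj_lt.
rewrite leq_eqVlt => /orP[/eqP->|]; first by rewrite modn_small ?padic_proj_lt.
rewrite ltnS => jk; rewrite IHk // /padic_proj -(padic_compat x k) /=.
by rewrite modn_dvdm // [X in (_ %| X)%N]pow_predK dvdn_exp2l.
Qed.

Lemma padic_proj_eq0P j k x : (j <= k)%N ->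
  reflect (padic_proj j x = 0) (val p ^ j %| padic_proj k x)%N.
Proof.
move=> jk; apply: (iffP idP) => [|x0].
  by move=> /eqP; rewrite -padic_proj_modn // => x0; apply: val_inj.
by apply/eqP; rewrite -padic_proj_modn // x0.
Qed.

Lemma padic_proj_eq0M i j x y :
  padic_proj i x = 0 -> padic_proj j y = 0 -> padic_proj (i + j) (x * y) = 0.
Proof.
move=> /(padic_proj_eq0P x (leq_addr j i)) xi /(padic_proj_eq0P y (leq_addl i j)) yj.
apply: val_inj => /=; apply/eqP; rewrite -/(dvdn _ _).
have dvd_xy := dvdn_mul xi yj; rewrite -expnD in dvd_xy.
by apply: dvdn_trans dvd_xy; rewrite pow_predK.
Qed.

Lemma padic_proj_logn n : padic_proj (logn (val p) n) (n%:R : padic p) = 0.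
Proof.
rewrite padic_proj_nat; apply: val_inj; rewrite /= pow_predK.
by apply/eqP; exact: pfactor_dvdnn.
Qed.

End PadicRing.

Definition in_Rtau (tau : forall p : primes_nat, padic p) (f : {poly rat}) : Prop :=
  exists (h : {poly int}) (n : nat),
    [/\ (0 < n)%N,
        f = (n%:R)^-1 *: map_poly intr h
      & forall p : primes_nat,
          padic_proj (logn (val p) n) (map_poly intr h).[tau p] = 0].

Section Rtau.
Variable tau : forall p : primes_nat, padic p.

Definition Rtau_pred : {pred {poly rat}} := fun f => `[< in_Rtau tau f >].

Lemma Rtau_subring_closed : subring_closed Rtau_pred.
Proof.
have nz n : (0 < n)%N -> n%:R != 0 :> rat by rewrite Num.Theory.pnatr_eq0 lt0n.
split.
- apply/asboolP; exists 1, 1%N; split; [by []|by rewrite [map_poly _ _]rmorph1 invr1 scale1r|].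
  by move=> p; rewrite logn1; exact: (etrans (ord1 _) (esym (ord1 _))).
- move=> _ _ /asboolP[h1 [n1 [n1_gt0 -> h1P]]] /asboolP[h2 [n2 [n2_gt0 -> h2P]]].
  apply/asboolP; exists (n2%:R * h1 - n1%:R * h2), (n1 * n2)%N; split.
  + by rewrite muln_gt0 n1_gt0.
  + rewrite natrM invfM [map_poly _ (_ - _)]rmorphB /=.
    rewrite ![map_poly _ (_ * _)]rmorphM /= ![map_poly _ _%:R]rmorph_nat.
    rewrite scalerBr !mulr_natl -!scaler_nat !scalerA.
    by rewrite mulfVK ?nz // [n1%:R^-1 * _]mulrC mulfVK ?nz.
  + move=> p; rewrite lognM // rmorphB !rmorphM /= !rmorph_nat hornerD hornerN.
    rewrite !hornerM -!polyC_natr !hornerC padic_projD padic_projN.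
    rewrite (padic_proj_eq0M (padic_proj_logn p n1) (h2P p)) addnC.
    by rewrite (padic_proj_eq0M (padic_proj_logn p n2) (h1P p)) subr0.
- move=> _ _ /asboolP[h1 [n1 [n1_gt0 -> h1P]]] /asboolP[h2 [n2 [n2_gt0 -> h2P]]].
  apply/asboolP; exists (h1 * h2), (n1 * n2)%N; split.
  + by rewrite muln_gt0 n1_gt0.
  + by rewrite natrM invfM [map_poly _ (_ * _)]rmorphM /= -scalerAl -scalerAr scalerA.
  + by move=> p; rewrite lognM // rmorphM hornerM; apply: padic_proj_eq0M.
Qed.

Record Rtau := MkRtau { Rtau_val : {poly rat}; _ : Rtau_val \in Rtau_pred }.

HB.instance Definition _ := [isSub for Rtau_val].
HB.instance Definition _ := [Choice of Rtau by <:].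
HB.instance Definition _ :=
  GRing.SubChoice_isSubComNzRing.Build _ _ Rtau Rtau_subring_closed.

Definition Rtau_unit : {pred Rtau} := fun x => `[< exists y, y * x = 1 >].

Definition Rtau_inv (x : Rtau) : Rtau :=
  if pselect (exists y, y * x == 1) is left xU then xchoose xU else x.

Fact Rtau_mulVx : {in Rtau_unit, left_inverse 1 Rtau_inv *%R}.
Proof.
move=> x /asboolP[y yx]; rewrite /Rtau_inv; case: pselect => [xU|[]].
  by apply/eqP; exact: (xchooseP xU).
by exists y; apply/eqP.
Qed.

Fact Rtau_unitPl (x y : Rtau) : y * x = 1 -> Rtau_unit x.
Proof. by move=> yx; apply/asboolP; exists y. Qed.

Fact Rtau_invr_out : {in [predC Rtau_unit], Rtau_inv =1 id}.
Proof.
move=> x /negP xNU; rewrite /Rtau_inv; case: pselect => // xU.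
by case: xNU; have [y /eqP yx] := xU; apply/asboolP; exists y.
Qed.

HB.instance Definition _ := GRing.ComNzRing_hasMulInverse.Build Rtau
  Rtau_mulVx Rtau_unitPl Rtau_invr_out.

Fact Rtau_mulf_eq0 (x y : Rtau) : x * y = 0 -> (x == 0) || (y == 0).
Proof.
move=> /(congr1 val) /eqP; rewrite [val (_ * _)]rmorphM [val 0]rmorph0 mulf_eq0.
by rewrite -!val_eqE [val 0]rmorph0.
Qed.

HB.instance Definition _ := GRing.ComUnitRing_isIntegral.Build Rtau Rtau_mulf_eq0.

End Rtau.

Section StageEuclidean.
Variable R : idomainType.

(* The sequence a :: b :: r lists r_{-1}, r_0, r_1, ..., r_l, and q lists
   q_1, ..., q_l, so that index i below stands for i + 1. *)
Definition division_chain (a b : R) (l : nat) (q r : l.-tuple R) : Prop :=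
  let s := [:: a, b & r] in
  forall i : nat, (i < l)%N -> s`_i = q`_i * s`_i.+1 + s`_i.+2.

Definition is_norm (N : R -> nat) : Prop := forall a, N a = 0%N <-> a = 0.

Definition stage_euclidean_for (k : nat) (N : R -> nat) : Prop :=
  forall a b : R, b != 0 ->
    exists (l : nat) (q r : l.-tuple R),
      [/\ (0 < l <= k)%N, division_chain a b q r & (N (last b r) < N b)%N].

Definition stage_euclidean (k : nat) : Prop :=
  exists N : R -> nat, is_norm N /\ stage_euclidean_for k N.

End StageEuclidean.

(* Main.v *)
Require Import Defs.
From HB Require Import structures.
From mathcomp Require Import all_boot all_order all_algebra.
From mathcomp Require Import boolp ring lra.

(** Order Q[x] by the sign of the leading coefficient. A constant of R_tau is
    an integer, since its denominator divides it at every prime; so R_tau is a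
    discretely ordered ring: nothing lies strictly between 0 and 1. Its
    nonconstant positive elements are exactly the infinitely large ones.

    In any discretely ordered ring, arbitrary division chains can hardly be
    faster than the Euclidean algorithm with positive remainders. Suppose that
    this algorithm, run on (a, b), performs n divisions with all its remainders
    infinitely large. Replacing (a, b) by (b, a - q b), for any q whatsoever,
    then costs at most three divisions, up to a common change of sign
    ([euclid_in_rotate]): translating a by multiples of b does not change the
    remainders, swapping a and b shifts the algorithm by one division, and
    negating a only disturbs its first two divisions ([euclid_in_opp]). Hence a
    chain of length l starting from a pair with at least 3 l such divisions ends
    in an infinitely large remainder, up to sign ([euclid_in_pm_chain]).

    For every nonconstant b in R_tau and every n there is an a such that the
    algorithm performs n divisions on (a, b) with remainders of the same degree
    as b ([long_euclid]): take a of that degree too, the ratio of the leading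
    coefficients being a quotient of consecutive terms of a Fibonacci-like
    sequence. Such an a exists because the Chinese remainder theorem puts
    (x - m) / v in R_tau for every v > 0 and a suitable m, so that every
    rational number is a leading coefficient of R_tau in each positive degree
    ([Rtau_lead_coef]).

    So if R_tau were k-stage Euclidean for a norm N, every nonconstant b would
    yield, through an a with 3 k such divisions, a nonconstant element of
    smaller norm: an infinite descent. *)

Set Implicit Arguments.
Unset Strict Implicit.
Unset Printing Implicit Defensive.

Import Order.TTheory GRing.Theory Num.Theory.
Local Open Scope ring_scope.

(** * Division chains in discretely ordered rings *)

Section DiscretelyOrdered.
Variable R : realDomainType.
Variable U : R -> Prop.
Hypothesis R_discrete : forall x : R, 0 < x -> 1 <= x.
Hypothesis U_up : forall x y : R, 0 < x -> U x -> x <= y -> U y.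

(** [U] is meant for the infinitely large elements. Being upward closed, it
    contains all the divisors met by the algorithm as soon as it contains the
    last one, so only the latter is tested. *)
Fixpoint euclid_in (n : nat) (a b : R) : Prop :=
  if n is n'.+1 then
    exists q r, [/\ a = q * b + r, 0 < r < b & euclid_in n' b r]
  else 0 < b /\ U b.

Lemma euclid_in_divisor n a b : euclid_in n a b -> 0 < b /\ U b.
Proof.
elim: n a b => [//|n IHn] a b [q [r [_ /andP[r0 rb] /IHn[_ Ur]]]].
by split; [exact: lt_trans rb | exact: U_up Ur (ltW rb)].
Qed.

Lemma euclid_inS n a b : euclid_in n.+1 a b -> euclid_in n a b.
Proof.
elim: n a b => [|n IHn] a b; first exact: euclid_in_divisor.
by move=> [q [r [-> rb /IHn Gbr]]]; exists q, r.
Qed.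

Lemma euclid_in_leq m n a b : (m <= n)%N -> euclid_in n a b -> euclid_in m a b.
Proof.
move=> /subnK <-; elim: (n - m)%N => // i IHi.
by rewrite addSn => /euclid_inS.
Qed.

Lemma euclid_in_shift n c a b : euclid_in n a b -> euclid_in n (c * b + a) b.
Proof.
case: n => [//|n] [q [r [-> rb Gbr]]].
by exists (c + q), r; split=> //; rewrite mulrDl addrA.
Qed.

(** If a = q b + r with 0 < r < b, the remainder of - a is b - r, and only the
    next quotient q1 in b = q1 r + r1 matters. If q1 = 1 then b - r = r1, so
    that one division is skipped. Otherwise r < b - r, and one division is
    inserted: b = 1 (b - r) + r is followed by b - r = (q1 - 1) r + r1. *)
Lemma euclid_in_opp n a b : euclid_in n.+1 a b -> euclid_in n (- a) b.
Proof.
case: n => [|n]; first exact: euclid_in_divisor.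
move=> [q [r [-> /andP[r0 rb]]]] [q1 [r1 [Db /andP[r10 r1r] Grr1]]].
exists (- q - 1), (b - r); split; [by ring | by lra |].
have [q1_le1|/= q1_gt1] := lerP q1 1.
  have q1_gt0 : 0 < q1 by rewrite -(pmulr_lgt0 _ r0); lra.
  have q1E : q1 = 1 by apply/le_anti; rewrite q1_le1 R_discrete.
  have -> : b - r = r1 by rewrite Db q1E; ring.
  by rewrite Db q1E mul1r addrC -[r1 in r1 + r]mul1r; exact: euclid_in_shift.
have q1_ge2 : 1 <= q1 - 1 by apply: R_discrete; lra.
have rbr : r < b - r.
  have : 1 * r <= (q1 - 1) * r by rewrite ler_pM2r.
  by lra.
apply/euclid_inS/euclid_inS; exists 1, r; split; [by ring | by rewrite r0 |].
exists (q1 - 1), r1; split=> //; last by rewrite r10.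
by rewrite {1}Db; ring.
Qed.

(** If a < b, then (b, a) is what the first division of (a, b) leads to; if
    a > b, the algorithm run on (b, a) first swaps its arguments back, by a
    division with quotient 0. *)
Lemma euclid_in_swap n a b : 0 < a -> euclid_in n.+1 a b -> euclid_in n b a.
Proof.
move=> a0 Gab; have [q [r [Da /andP[r0 rb] Gbr]]] := Gab.
have b0 := lt_trans r0 rb.
have [q_le0|q_gt0] := lerP q 0.
  have q_gtN1 : 0 < q + 1 by rewrite -(pmulr_lgt0 _ b0); lra.
  have q0 : q = 0 by apply/le_anti; rewrite q_le0; have := R_discrete q_gtN1; lra.
  by rewrite Da q0 mul0r add0r.
have ba : b < a.
  have : 1 * b <= q * b by rewrite ler_pM2r // R_discrete.
  by lra.
by apply/euclid_inS/euclid_inS; exists 0, b; split; [ring | rewrite b0 |].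
Qed.

(** The algorithm runs with positive divisors, whereas the remainders of a
    division chain may be negative: a pair is identified with its opposite,
    which has the same quotients. *)
Definition euclid_in_pm n a b := euclid_in n a b \/ euclid_in n (- a) (- b).

Lemma euclid_in_pm_leq m n a b :
  (m <= n)%N -> euclid_in_pm n a b -> euclid_in_pm m a b.
Proof. by move=> mn [] /(euclid_in_leq mn); [left | right]. Qed.

(** Since (r, b) has the same remainders as (a, b), it remains to swap its
    entries; if r < 0, this takes one negation before and one after the swap,
    so that three divisions are lost at most. *)
Lemma euclid_in_rotate n a b q r : a = q * b + r ->
  euclid_in n.+3 a b -> euclid_in_pm n b r.
Proof.
move=> Da Gab.
have {Gab} Grb : euclid_in n.+3 r b.
  by have := euclid_in_shift (- q) Gab; rewrite Da mulNr addKr.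
have [r0|r0|r0] := ltrgt0P r.
- by left; do 2!apply: euclid_inS; exact: euclid_in_swap.
- right; apply: euclid_in_opp; apply: euclid_in_swap; first by rewrite oppr_gt0.
  exact: euclid_in_opp.
(* If r = 0, discreteness excludes a remainder strictly between 0 and b. *)
case: Grb => [c [s [Dr /andP[s0 sb] _]]].
have b0 := lt_trans s0 sb.
have c1 : 0 < c + 1 by rewrite -(pmulr_lgt0 _ b0); lra.
have c0 : 0 < - c by rewrite -(pmulr_lgt0 _ b0); lra.
by have := R_discrete c1; lra.
Qed.

Lemma euclid_in_pm_rotate n a b q r : a = q * b + r ->
  euclid_in_pm n.+3 a b -> euclid_in_pm n b r.
Proof.
move=> Da [|Gab]; first exact: euclid_in_rotate Da.
have DNa : - a = q * - b - r by rewrite Da mulrN opprD.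
have [|] := euclid_in_rotate DNa Gab; first by right.
by rewrite !opprK; left.
Qed.

Lemma euclid_in_pm_chain a b l (q r : l.-tuple R) :
  division_chain a b q r -> euclid_in_pm (l * 3) a b ->
  U (last b r) \/ U (- last b r).
Proof.
(* The induction on l runs over plain sequences: beheading the quotients then
   just shifts their indices, entries past the end reading as 0. *)
suff chain (q' r' : seq R) : size r' = l ->
  (forall i, (i < l)%N ->
    [:: a, b & r']`_i = q'`_i * [:: a, b & r']`_i.+1 + [:: a, b & r']`_i.+2) ->
  euclid_in_pm (l * 3) a b -> U (last b r') \/ U (- last b r').
  exact: chain (size_tuple r).
move=> {q r}; elim: l a b q' r' => [|l IHl] a b q' [|c r'] //=.
  by move=> _ _ [] /euclid_in_divisor[_]; [left | right].
move=> [sz_r] Dab Gab; apply: (IHl b c (behead q') r') => //.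
- by move=> i lt_il; rewrite nth_behead; exact: (Dab i.+1).
- exact: (euclid_in_pm_rotate (Dab 0%N isT) Gab).
Qed.

End DiscretelyOrdered.

(** * Simultaneous congruences modulo prime powers *)

Lemma chinese_prime_powers (s : seq nat) (e t : nat -> nat) :
  uniq s -> all prime s ->
  exists m, forall p, p \in s -> m = t p %[mod p ^ e p].
Proof.
elim: s => [|p s IHs] /=; first by exists 0%N.
move=> /andP[p_s uniq_s] /andP[p_pr s_pr].
have [m mP] := IHs uniq_s s_pr.
pose M := (\prod_(q <- s) q ^ e q)%N.
have co_pM : coprime (p ^ e p) M.
  rewrite /M big_seq; apply: (big_ind (coprime (p ^ e p))) => [|x y px py|q q_s].
  - exact: coprimen1.
  - by rewrite coprimeMr px.
  apply: coprimeXl; apply: coprimeXr.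
  rewrite prime_coprime // dvdn_prime2 // ?(allP s_pr) //.
  by apply: contraNneq p_s => ->.
exists (chinese (p ^ e p) M (t p) m) => q; rewrite inE => /predU1P[->|q_s].
  exact: chinese_modl.
rewrite -mP //; have qM : (q ^ e q %| M)%N by rewrite /M (big_rem q) //= dvdn_mulr.
by rewrite -(modn_dvdm _ qM) chinese_modr // modn_dvdm.
Qed.

(** * The order on R_tau *)

Lemma lead_coef_coef (A : nzSemiRingType) (f : {poly A}) d :
  (size f <= d.+1)%N -> f`_d != 0 -> lead_coef f = f`_d.
Proof.
move=> sz_f fd; have -> : d = (size f).-1; last by rewrite lead_coefE.
suff -> : size f = d.+1 by [].
apply/anti_leq; rewrite sz_f ltnNge; apply: contra_neqN fd.
exact: nth_default.
Qed.

Lemma lead_coefD_gt0 (f g : {poly rat}) :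
  0 < lead_coef f -> 0 < lead_coef g -> 0 < lead_coef (f + g).
Proof.
move=> f0 g0; have [gf|fg|fg] := ltngtP (size g) (size f).
- by rewrite lead_coefDl.
- by rewrite lead_coefDr.
have Dfg : (f + g)`_(size f).-1 = lead_coef f + lead_coef g.
  by rewrite coefD !lead_coefE fg.
have fg0 : 0 < lead_coef f + lead_coef g by exact: addr_gt0.
have sz_fg : (size (f + g)%R <= (size f).-1.+1)%N.
  by rewrite (leq_trans (size_polyD _ _)) // fg maxnn leqSpred.
by rewrite (lead_coef_coef sz_fg) Dfg // gt_eqF.
Qed.

Section RtauOrder.
Variable tau : forall p : primes_nat, padic p.
Local Notation R := (Rtau tau).
Implicit Types x y a b : R.

Definition Rtau_lt x y := 0 < lead_coef (val y - val x).
Definition Rtau_le x y := (x == y) || Rtau_lt x y.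
Definition Rtau_norm x := if Rtau_lt 0 x then x else - x.

Lemma Rtau_lt0E x : Rtau_lt 0 x = (0 < lead_coef (val x)).
Proof. by rewrite /Rtau_lt [val 0]rmorph0 subr0. Qed.

Fact Rtau_lt0D x y : Rtau_lt 0 x -> Rtau_lt 0 y -> Rtau_lt 0 (x + y).
Proof. by rewrite !Rtau_lt0E; exact: lead_coefD_gt0. Qed.

Fact Rtau_lt0M x y : Rtau_lt 0 x -> Rtau_lt 0 y -> Rtau_lt 0 (x * y).
Proof. by rewrite !Rtau_lt0E [val (x * y)]rmorphM lead_coefM; exact: mulr_gt0. Qed.

Fact Rtau_lt0_asym x : Rtau_lt 0 x -> ~~ Rtau_lt x 0.
Proof.
rewrite Rtau_lt0E /Rtau_lt [val 0]rmorph0 sub0r lead_coefN oppr_gt0 => x0.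
by rewrite -leNgt ltW.
Qed.

Fact Rtau_sub_gt0 x y : Rtau_lt 0 (y - x) = Rtau_lt x y.
Proof. by rewrite Rtau_lt0E [val (y - x)]rmorphB. Qed.

Fact Rtau_lt0_total x : x != 0 -> Rtau_lt 0 x || Rtau_lt x 0.
Proof.
rewrite Rtau_lt0E /Rtau_lt [val 0]rmorph0 sub0r lead_coefN oppr_gt0 orbC.
by rewrite -val_eqE [val 0]rmorph0 -lead_coef_eq0 neq_lt.
Qed.

Fact Rtau_normN x : Rtau_norm (- x) = Rtau_norm x.
Proof.
have [->|nz_x] := eqVneq x 0; first by rewrite oppr0.
rewrite /Rtau_norm opprK -sub0r Rtau_sub_gt0.
case: ifP => [|xN]; last by have := Rtau_lt0_total nz_x; rewrite xN orbF => ->.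
by rewrite sub0r; case: ifP => // /Rtau_lt0_asym/negPf->.
Qed.

Fact Rtau_ge0_norm x : Rtau_le 0 x -> Rtau_norm x = x.
Proof.
rewrite /Rtau_norm => /predU1P[<-|->//].
by rewrite oppr0; case: ifP.
Qed.

(** The order of Q[x] in which x is larger than every constant. *)
HB.instance Definition _ := Num.IntegralDomain_isLtReal.Build R
  Rtau_lt0D Rtau_lt0M Rtau_lt0_asym Rtau_sub_gt0 Rtau_lt0_total
  Rtau_normN Rtau_ge0_norm (fun x y => erefl).

Lemma Rtau_gt0E x : (0 < x) = (0 < lead_coef (val x)).
Proof. exact: Rtau_lt0E. Qed.

Lemma padic_proj00 (p : primes_nat) (x : padic p) : padic_proj 0 x = 0.
Proof. exact: (etrans (ord1 _) (esym (ord1 _))). Qed.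

(** Membership in R_tau forces the p-part of the denominator n of a constant
    c / n to divide c, for every prime p. *)
Lemma Rtau_const_int x : (size (val x) <= 1)%N -> exists m : int, val x = m%:~R.
Proof.
case: x => f /= /[dup] /asboolP[h [n [n_gt0 Df hP]]] _ sz_f.
have nz_n : n%:R != 0 :> rat by rewrite pnatr_eq0 -lt0n.
have sz_h : (size h <= 1)%N.
  move: sz_f; rewrite Df size_scale ?invr_eq0 // size_map_inj_poly //.
  exact: intr_inj.
move/size1_polyC: sz_h (hP) => Dh; rewrite Dh in Df *.
move: (h`_0) Df => c Df {}hP.
have n_dv_c : (n %| `|c|)%N.
  apply/dvdn_partP => // p p_n.
  have p_pr : prime p by move: p_n; rewrite mem_primes => /andP[].
  have := hP (exist _ p p_pr); rewrite map_polyC hornerC /=.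
  have -> : (c%:~R : padic (exist _ p p_pr)) = (-1) ^+ (c < 0)%R * `|c|%:R.
    by rewrite {1}[c]intEsign rmorphM rmorph_sign /= pmulrn.
  rewrite p_part => cP.
  have {cP} : padic_proj (logn p n) (`|c|%:R : padic (exist _ p p_pr)) = 0.
    by case: (c < 0)%R cP; rewrite ?mul1r // mulN1r padic_projN => /eqP; rewrite oppr_eq0 => /eqP.
  rewrite padic_proj_nat => /(congr1 val) /=; rewrite prednK ?expn_gt0 ?prime_gt0 // => /eqP.
  by rewrite /dvdn.
have /dvdzP[m Dc] : (n %| c)%Z by rewrite /dvdz /=.
exists m; rewrite Df Dc map_polyC /= intrM pmulrn.
rewrite -mul_polyC -polyCM mulrCA mulVf ?pmulrn // mulr1.
exact: rmorph_int.
Qed.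

(** For a nonconstant x, the leading coefficient of x - 1 is that of x. *)
Lemma Rtau_discrete x : 0 < x -> 1 <= x.
Proof.
have [/Rtau_const_int[m Dx]|x_big] := leqP (size (val x)) 1; last first.
  rewrite le_eqVlt -[1 < x]subr_gt0 !Rtau_gt0E [val (x - 1)]rmorphB rmorph1.
  by rewrite lead_coefDl ?size_polyN ?size_poly1 // => ->; rewrite orbT.
have {Dx} -> : x = m%:~R by apply: val_inj; rewrite Dx [RHS]rmorph_int.
by rewrite ltr0z ler1z.
Qed.

Definition nonconstant x : Prop := (1 < size (val x))%N.

Lemma nonconstant_up x y : 0 < x -> nonconstant x -> x <= y -> nonconstant y.
Proof.
move=> x0 x_big; rewrite /nonconstant !ltnNge; apply: contraTN.
move=> y_const; rewrite -ltNge -subr_gt0 Rtau_gt0E [val (x - y)]rmorphB.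
rewrite lead_coefDl ?size_polyN; first by rewrite -Rtau_gt0E.
exact: leq_ltn_trans y_const x_big.
Qed.

(** * Leading coefficients of R_tau *)

(** The residues of tau_p modulo the prime powers dividing v have a common
    integer representative m, so x - m vanishes at tau to the order required by
    the denominator v. *)
Lemma Rtau_linear (v : nat) : (0 < v)%N ->
  exists m : nat, in_Rtau tau (v%:R^-1 *: ('X - m%:R%:P)).
Proof.
move=> v_gt0; pose t p := if insub p is Some p' then
  nat_of_ord (padic_proj (logn p v) (tau p')) else 0%N.
have primes_v : all prime (primes v).
  by apply/allP=> p; rewrite mem_primes => /andP[].
have [m mP] := chinese_prime_powers (logn^~ v) t (primes_uniq v) primes_v.
exists m, ('X - m%:R%:P), v; split=> // [|p].
  by rewrite [map_poly _ _]rmorphB /= map_polyX map_polyC /= mulrz_nat.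
rewrite rmorphB /= map_polyX map_polyC /= mulrz_nat hornerXsubC.
have [p_v|] := boolP (val p \in primes v); last first.
  by rewrite -logn_gt0 -eqn0Ngt => /eqP->; exact: padic_proj00.
rewrite padic_projD padic_projN padic_proj_nat; apply/eqP; rewrite subr_eq0 -val_eqE /=.
rewrite [X in (m %% X)%N]pow_predK mP // /t valK modn_small //; exact: padic_proj_lt.
Qed.

Lemma Rtau_lead_coef (d : nat) (c : rat) :
  exists a, (size (val a) <= d.+2)%N /\ (val a)`_d.+1 = c.
Proof.
pose v := `|denq c|%N.
have v_gt0 : (0 < v)%N by rewrite absz_gt0 denq_neq0.
have [m /asboolP mP] := Rtau_linear v_gt0.
have Xin : ('X : {poly rat}) \in Rtau_pred tau.
  apply/asboolP; exists 'X, 1%N; split=> // [|p].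
    by rewrite map_polyX invr1 scale1r.
  by rewrite logn1; exact: padic_proj00.
exists ((numq c)%:~R * MkRtau mP * MkRtau Xin ^+ d).
rewrite !rmorphM rmorphXn rmorph_int /=.
have -> : ((numq c)%:~R * (v%:R^-1 *: ('X - m%:R%:P)) * 'X^d : {poly rat})
   = c *: (('X - m%:R%:P) * 'X^d).
  have Dc : c = (numq c)%:~R * v%:R^-1 by rewrite -[LHS]divq_num_den pmulrn absz_denq.
  by rewrite [in RHS]Dc -mulrA -scalerAl mulrzl -scaler_int scalerA.
split.
  apply: leq_trans (size_scale_leq _ _) _.
  by rewrite size_Mmonic ?monicXn ?polyXsubC_eq0 // size_polyXn size_XsubC.
by rewrite coefZ coefMXn ltnNge leqnSn /= subSn // subnn coefB coefX coefC subr0 mulr1.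
Qed.

(** * Long Euclidean algorithms among the nonconstant elements *)

Lemma Rtau_gt0_nonconstant d a : (size (val a) <= d.+2)%N ->
  0 < (val a)`_d.+1 -> 0 < a /\ nonconstant a.
Proof.
move=> sz_a a0; rewrite Rtau_gt0E (lead_coef_coef sz_a) ?gt_eqF //.
split=> //; rewrite /nonconstant ltnNge; apply: contraTN a0 => sz_a1.
by rewrite nth_default ?ltxx // (leq_trans sz_a1).
Qed.

(** With ratio 1 + 1 / rho the first quotient is 1, and the ratio becomes rho:
    the ratios are those of consecutive terms of a Fibonacci-like sequence.
    Both 0 < a - b and a - b < b are decided by leading coefficients, the
    latter because rho > 1. *)
Lemma long_euclid_ratio n : exists2 rho : rat, 1 < rho &
  forall d a b, (size (val a) <= d.+2)%N -> (size (val b) <= d.+2)%N ->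
    0 < (val b)`_d.+1 -> (val a)`_d.+1 = rho * (val b)`_d.+1 ->
    euclid_in nonconstant n a b.
Proof.
elim: n => [|n [rho rho1 IHn]].
  by exists 2%:R => // d a b _ sz_b b0 _; exact: Rtau_gt0_nonconstant sz_b b0.
have rho0 : 0 < rho by exact: lt_trans rho1.
exists (1 + rho^-1); first by rewrite ltrDl invr_gt0.
move=> d a b sz_a sz_b b0 Dab.
have sz_sub (x y : R) : (size (val x) <= d.+2)%N -> (size (val y) <= d.+2)%N ->
    (size (val (x - y)%R) <= d.+2)%N.
  move=> sz_x sz_y; rewrite rmorphB (leq_trans (size_polyD _ _)) //.
  by rewrite geq_max size_polyN sz_x.
have sz_r := sz_sub a b sz_a sz_b.
have Dr : (val (a - b))`_d.+1 = rho^-1 * (val b)`_d.+1.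
  by rewrite rmorphB coefB Dab mulrDl mul1r addrC addKr.
exists 1, (a - b); split; first by rewrite mul1r addrC subrK.
  apply/andP; split.
    have [] // := Rtau_gt0_nonconstant sz_r.
    by rewrite Dr mulr_gt0 // invr_gt0.
  rewrite -subr_gt0; have [] // := Rtau_gt0_nonconstant (sz_sub b (a - b) sz_b sz_r).
  rewrite rmorphB coefB Dr -[X in X - _]mul1r -mulrBl mulr_gt0 // subr_gt0.
  by rewrite invf_lt1.
apply: (IHn d) => //; first by rewrite Dr mulr_gt0 // invr_gt0.
by rewrite Dr mulrA mulfV ?mul1r // gt_eqF.
Qed.

Lemma long_euclid n b : nonconstant b ->
  exists a, euclid_in_pm nonconstant n a b.
Proof.
wlog b0 : b / 0 < b => [wlog_b0 b_big|].
  have [b0|b0|b0] := ltrgt0P b; first exact: wlog_b0.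
    have [||a Ga] := wlog_b0 (- b); first by rewrite oppr_gt0.
      by rewrite /nonconstant [val _]rmorphN size_polyN.
    by exists (- a); case: Ga => Ga; [right | left; rewrite opprK in Ga]; rewrite ?opprK.
  by move: b_big; rewrite b0 /nonconstant [val _]rmorph0 size_poly0.
rewrite /nonconstant; case sz_b : (size (val b)) => [|[|d]] // _.
have [rho _ rhoP] := long_euclid_ratio n.
have [a [sz_a Da]] := Rtau_lead_coef d (rho * (val b)`_d.+1).
exists a; left; apply: (rhoP d) => //; first by rewrite sz_b.
by move: b0; rewrite Rtau_gt0E lead_coefE sz_b.
Qed.

End RtauOrder.

Theorem theorem3p9 (tau : forall p : primes_nat, padic p) (k : nat)
  (hk : (0 < k)%N) : ~ stage_euclidean (Rtau tau) k.
Proof.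
move=> [N [_ stageN]].
suff no_nonconstant n b : (N b < n)%N -> ~ nonconstant b.
  have [a [sz_a Da]] := Rtau_lead_coef tau 0 1.
  have [_ a_big] : 0 < a /\ nonconstant a by apply: Rtau_gt0_nonconstant sz_a _; rewrite Da.
  exact: no_nonconstant (ltnSn (N a)) a_big.
elim: n b => [//|n IHn] b; rewrite ltnS => N_b b_big.
have [a Gab] := long_euclid (k * 3) b_big.
have nz_b : b != 0 by apply: contraTneq b_big => ->; rewrite /nonconstant [val _]rmorph0 size_poly0.
have [l [q [r [/andP[_ lk] chain N_lt]]]] := stageN a b nz_b.
have Gl : euclid_in_pm (@nonconstant tau) (l * 3) a b.
  exact: (euclid_in_pm_leq (@nonconstant_up tau) (leq_mul lk (leqnn 3)) Gab).
have := euclid_in_pm_chain (@Rtau_discrete tau) (@nonconstant_up tau) chain Gl.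
have N_last : (N (last b r) < n)%N by exact: leq_trans N_lt N_b.
move: (IHn _ N_last) => last_const [//|].
by rewrite /nonconstant [val _]rmorphN size_polyN.
Qed.
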